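(* Let $u_1,\ldots,u_6$ and $v_1,\ldots,v_6$ be the columns of the matrices $$U=[u_1,\ldots,u_6]=\begin{pmatrix}1&0&0&0&1&1\\0&1&0&0&0&1\\0&0&1&0&-4&2\\0&0&0&1&-3&3\end{pmatrix},\qquad V=[v_1,\ldots,v_6]=\begin{pmatrix}0&5&-1&-1&-17&-5\\-5&0&0&5&4&4\\2&-2&0&-3&-2&2\\-2&1&0&0&-3&-1\end{pmatrix},$$ and let $W_j:=\mathrm{span}\{u_j,v_j\}\subset\mathbb{R}^4$ for $j=1,\ldots,6$. Then $\{W_j\}_{j=1}^6$ yields phase retrieval in $\mathbb{R}^4$: if $x,y\in\mathbb{R}^4$ satisfy $\|P_jx\|=\|P_jy\|$ for all $j=1,\ldots,6$, where $P_j:\mathbb{R}^4\to W_j$ is the orthogonal projection onto $W_j$, then $x=y$ or $x=-y$.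
   Context: $\|\cdot\|$ is the Euclidean norm. A family of subspaces $\{W_j\}_{j=1}^m$ of $\mathbb{R}^n$, with orthogonal projections $P_j:\mathbb{R}^n\to W_j$, is said to yield phase retrieval if for all $x,y\in\mathbb{R}^n$ satisfying $\|P_jx\|=\|P_jy\|$ for all $j=1,\ldots,m$ one has $x=\pm y$. *)

(* Defs.v *)
From HB Require Import structures.
From mathcomp Require Import all_boot all_order all_algebra.
From mathcomp Require Import reals.

Set Implicit Arguments.
Unset Strict Implicit.
Unset Printing Implicit Defensive.

Import Order.TTheory GRing.Theory Num.Theory.
Local Open Scope ring_scope.

Definition dot (R : rcfType) n (x y : 'cV[R]_n) : R := \sum_i x i 0 * y i 0.

(* The norm [`|x|] that MathComp-Analysis puts on matrices is the max norm, so
   the Euclidean norm is defined here. *)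
Definition enorm (R : rcfType) n (x : 'cV[R]_n) : R := Num.sqrt (dot x x).

Fact dot_bilinear (R : rcfType) n :
  bilinear_for (GRing.Scale.Law.clone R R ( *%R ) _)
    (GRing.Scale.Law.clone R R (idfun \; *%R ) _) (@dot R n).
Proof.
by split=> [y a u v|x a u v] /=; rewrite /dot mulr_sumr -big_split /=;
  apply: eq_bigr => i _; rewrite !mxE ?mulrDl ?mulrDr ?mulrA // [x i 0 * a]mulrC.
Qed.

HB.instance Definition _ (R : rcfType) n :=
  bilinear_isBilinear.Build R 'cV[R]_n 'cV[R]_n R
    (GRing.Scale.Law.clone R R ( *%R ) _)
    (GRing.Scale.Law.clone R R (idfun \; *%R ) _) (@dot R n) (@dot_bilinear R n).

Fact dot_sym (R : rcfType) n (x y : 'cV[R]_n) :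
  dot x y = (-1) ^+ false * idfun (dot y x).
Proof. by rewrite mul1r /dot; apply: eq_bigr => i _; rewrite mulrC. Qed.

HB.instance Definition _ (R : rcfType) n :=
  isHermitianSesquilinear.Build R 'cV[R]_n false idfun (@dot R n)
    (@dot_sym R n).

Fact dot_pos (R : rcfType) n (x : 'cV[R]_n) : x != 0 -> 0 < dot x x.
Proof.
move=> x0; rewrite lt_def sumr_ge0 ?andbT => [|i _]; last by rewrite -expr2 sqr_ge0.
apply: contra x0 => /eqP/psumr_eq0P xx0; apply/eqP/colP => i; rewrite mxE.
apply/eqP; rewrite -sqrf_eq0 expr2; apply/eqP.
by apply: xx0 => // k _; rewrite -expr2 sqr_ge0.
Qed.

HB.instance Definition _ (R : rcfType) n :=
  isDotProduct.Build R 'cV[R]_n (@dot R n) (@dot_pos R n).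

(* [daddv_pi U V] is the projection onto [U] along [V] only when [U] and [V] are
   complementary; [capv_orthov] and [addv_orthov] check this, and
   [orthoproj_mem] and [orthoproj_ortho] characterize the projection. *)
Definition orthoproj (R : rcfType) n (W : {vspace 'cV[R]_n}) : 'End('cV[R]_n) :=
  daddv_pi W (orthov (@dot R n) W).

Lemma capv_orthov (R : rcfType) n (W : {vspace 'cV[R]_n}) :
  (W :&: orthov (@dot R n) W = 0)%VS.
Proof.
apply/eqP; rewrite -subv0; apply/subvP => x; rewrite memv_cap memv0.
move=> /andP[xW /mem_orthovP/(_ x xW) /= xx0]; apply/negPn/negP => /dot_pos.
by rewrite xx0 ltxx.
Qed.

Lemma addv_orthov (R : rcfType) n (W : {vspace 'cV[R]_n}) :
  (W + orthov (@dot R n) W = fullv)%VS.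
Proof.
pose g (x : 'cV[R]_n) : 'rV[R]_(\dim W) := \row_i dot (vbasis W)`_i x.
have g_lin : linear g.
  by move=> a x y; apply/rowP => i; rewrite !mxE linearPr.
pose gL : {linear 'cV[R]_n -> 'rV[R]_(\dim W)} :=
  HB.pack g (GRing.isLinear.Build _ _ _ _ g g_lin).
have kerg : (lker (linfun gL) <= orthov (@dot R n) W)%VS.
  apply/subvP => x; rewrite memv_ker lfunE /= => /eqP/rowP gx0.
  apply/mem_orthovP => v vW /=; rewrite (coord_vbasis vW) linear_sumr big1 //= => i _.
  by rewrite linearZr /= dot_sym mul1r; have := gx0 i; rewrite !mxE => ->; rewrite mulr0.
apply/eqP; rewrite eqEdim subvf /= dimv_disjoint_sum ?capv_orthov //.
have := limg_ker_dim (linfun gL) fullv; rewrite capfv => <-.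
rewrite addnC leq_add ?dimvS //.
by apply: leq_trans (dimvS (subvf _)) _; rewrite dimvf /dim /= mul1n.
Qed.

Lemma orthoproj_mem (R : rcfType) n (W : {vspace 'cV[R]_n}) x :
  orthoproj W x \in W.
Proof. exact: memv_pi. Qed.

Lemma orthoproj_ortho (R : rcfType) n (W : {vspace 'cV[R]_n}) x w :
  w \in W -> dot (x - orthoproj W x) w = 0.
Proof.
move=> wW; apply: (mem_orthovP (form := @dot R n)) wW.
have /(daddv_pi_add (capv_orthov W)) : x \in (W + orthov (@dot R n) W)%VS.
  by rewrite addv_orthov memvf.
by rewrite /orthoproj => {1}<-; rewrite addrC addKr memv_pi.
Qed.

Definition yields_phase_retrieval (R : rcfType) n m
    (W : 'I_m -> {vspace 'cV[R]_n}) : Prop :=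
  forall x y : 'cV[R]_n,
    (forall j, enorm (orthoproj (W j) x) = enorm (orthoproj (W j) y)) ->
    x = y \/ x = - y.

Definition matU (R : rcfType) : 'M[R]_(4, 6) :=
  \matrix_(i, j) (nth [::]
    [:: [:: 1; 0; 0; 0;   1; 1];
        [:: 0; 1; 0; 0;   0; 1];
        [:: 0; 0; 1; 0; - 4; 2];
        [:: 0; 0; 0; 1; - 3; 3]] i)`_j.

Definition matV (R : rcfType) : 'M[R]_(4, 6) :=
  \matrix_(i, j) (nth [::]
    [:: [::   0;   5; - 1; - 1; - 17; - 5];
        [:: - 5;   0;   0;   5;    4;   4];
        [::   2; - 2;   0; - 3;  - 2;   2];
        [:: - 2;   1;   0;   0;  - 3; - 1]] i)`_j.

(* Main.v *)
Require Import Defs.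
From mathcomp Require Import all_boot all_order all_algebra.
From mathcomp Require Import reals.
From mathcomp Require Import ring lra.

(* Put a = x + y and b = x - y.  Equality of the six norms says that
   tr(P_j Q) = 0 for all j, where Q = a b^T + b a^T is a symmetric matrix of rank
   at most 2, and the theorem says that Q = 0.  The six linear conditions cut the
   10-dimensional space of symmetric 4 x 4 matrices down to a 4-dimensional
   space, with integral coordinates t0, ..., t3, on which the 3 x 3 minors are
   cubic forms in the t_i.  These minors have no common real zero besides 0 (over
   the complex numbers they vanish at 10 points, in 5 conjugate pairs), and this
   has a certificate of the lowest possible degree: a combination of the minors
   with linear coefficients is a positive definite sum of squares of quadratic
   forms in the t_i. *)

Set Implicit Arguments.
Unset Strict Implicit.
Unset Printing Implicit Defensive.

Import Order.TTheory GRing.Theory Num.Theory.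
Local Open Scope ring_scope.

(** Expanded in its entries, taken row by row, so that [ring] can compute with it. *)
Definition det3 (R : pzRingType) (a b c d e f g h i : R) : R :=
  a * (e * i - f * h) - b * (d * i - f * g) + c * (d * h - e * g).

(* The numbers come from the sum, over the 10 complex zeros z of the minors, of
   |w_z|^2, where the quadratic form w_z vanishes at all the zeros except z.  This
   quartic form has a positive definite Gram matrix, and it vanishes at every z
   because z is not real, so it lies in the ideal of the minors.  Its coefficients
   in that ideal were rounded to integers, and the rounding error is absorbed by
   the squares of binomials.  Large coefficients are split because numerals are
   unary natural numbers. *)
Definition sos_part (R : pzRingType) (t0 t1 t2 t3 : R) : R :=
  2 * 10 ^+ 4 * (131 * t0 ^+ 2 + 20 * t0 * t1 + 128 * t0 * t2 + 197 * t0 * t3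
    + 183 * t1 ^+ 2 + 26 * t1 * t2 - 501 * t1 * t3 - 238 * t2 ^+ 2 + 900 * t2
    * t3 + 563 * t3 ^+ 2) ^+ 2 +
  2 * 10 ^+ 4 * (213 * t0 * t1 + 60 * t0 * t2 + 487 * t0 * t3 + 207 * t1 ^+ 2
    + 443 * t1 * t2 + 551 * t1 * t3 - 396 * t2 ^+ 2 - 1358 * t2 * t3 - 262 *
    t3 ^+ 2) ^+ 2 +
  2 * 10 ^+ 4 * (314 * t0 * t2 - 68 * t0 * t3 - 62 * t1 ^+ 2 - 36 * t1 * t2 +
    181 * t1 * t3 + 355 * t2 ^+ 2 + 113 * t2 * t3 + 327 * t3 ^+ 2) ^+ 2 +
  2 * 10 ^+ 4 * (617 * t0 * t3 + 97 * t1 ^+ 2 + 243 * t1 * t2 + 426 * t1 * t3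
    - 73 * t2 ^+ 2 - 1092 * t2 * t3 + 748 * t3 ^+ 2) ^+ 2 +
  2 * 10 ^+ 4 * (195 * t1 ^+ 2 + 288 * t1 * t2 + 315 * t1 * t3 - 188 * t2 ^+ 2
    - 873 * t2 * t3 - 207 * t3 ^+ 2) ^+ 2 +
  2 * 10 ^+ 4 * (346 * t1 * t2 + 144 * t1 * t3 + 519 * t2 ^+ 2 - 138 * t2 * t3
    + 672 * t3 ^+ 2) ^+ 2 +
  2 * 10 ^+ 4 * (773 * t1 * t3 - 138 * t2 ^+ 2 - 148 * t2 * t3 - 46 * t3 ^+ 2)
    ^+ 2 +
  2 * 10 ^+ 4 * (139 * t2 ^+ 2 + 636 * t2 * t3 - 365 * t3 ^+ 2) ^+ 2 +
  2 * 10 ^+ 4 * (755 * t2 * t3 + 122 * t3 ^+ 2) ^+ 2 +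
  2 * 10 ^+ 4 * (1253 * t3 ^+ 2) ^+ 2 +
  (39 * 10 ^+ 4 + 9132) * (t0 ^+ 2 - t0 * t1) ^+ 2 +
  (54 * 10 ^+ 4 + 483) * (t0 ^+ 2 + t0 * t2) ^+ 2 +
  (98 * 10 ^+ 4 + 7731) * (t0 ^+ 2 - t0 * t3) ^+ 2 +
  (299 * 10 ^+ 4 + 8303) * (t0 * t1 - t0 * t2) ^+ 2 +
  (106 * 10 ^+ 4 + 7356) * (t0 * t1 + t0 * t3) ^+ 2 +
  (16 * 10 ^+ 4 + 6729) * (t0 * t2 - t0 * t3) ^+ 2 +
  (195 * 10 ^+ 4 + 6736) * (t1 ^+ 2 - t0 * t1) ^+ 2 +
  (119 * 10 ^+ 4 + 5488) * (t0 * t1 - t1 * t2) ^+ 2 +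
  (338 * 10 ^+ 4 + 2361) * (t0 * t1 + t1 * t3) ^+ 2 +
  (285 * 10 ^+ 4 + 8761) * (t0 * t2 - t1 * t2) ^+ 2 +
  (1322 * 10 ^+ 4 + 3498) * (t0 * t1 + t2 * t3) ^+ 2 +
  (1276 * 10 ^+ 4 + 107) * (t0 * t3 + t1 * t3) ^+ 2 +
  (320 * 10 ^+ 4 + 9107) * (t2 ^+ 2 - t0 * t2) ^+ 2 +
  (554 * 10 ^+ 4 + 4381) * (t0 * t2 + t2 * t3) ^+ 2 +
  (2058 * 10 ^+ 4 + 5050) * (t0 * t3 - t2 * t3) ^+ 2 +
  (1894 * 10 ^+ 4 + 9510) * (t3 ^+ 2 + t0 * t3) ^+ 2 +
  (110 * 10 ^+ 4 + 3172) * (t1 ^+ 2 - t1 * t2) ^+ 2 +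
  (548 * 10 ^+ 4 + 1632) * (t1 ^+ 2 - t1 * t3) ^+ 2 +
  (1363 * 10 ^+ 4 + 2377) * (t1 * t2 + t1 * t3) ^+ 2 +
  (235 * 10 ^+ 4 + 7066) * (t2 ^+ 2 - t1 * t2) ^+ 2 +
  (949 * 10 ^+ 4 + 2656) * (t1 * t2 - t2 * t3) ^+ 2 +
  (3616 * 10 ^+ 4 + 1779) * (t1 * t3 + t2 * t3) ^+ 2 +
  (532 * 10 ^+ 4 + 5480) * (t3 ^+ 2 + t1 * t3) ^+ 2 +
  (30 * 10 ^+ 4 + 821) * (t2 ^+ 2 - t2 * t3) ^+ 2 +
  (1123 * 10 ^+ 4 + 4200) * (t3 ^+ 2 - t2 * t3) ^+ 2 +
  (7383 * 10 ^+ 4 + 4882) * (t0 * t1) ^+ 2 +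
  (8052 * 10 ^+ 4 + 8256) * (t0 * t2) ^+ 2 +
  (6533 * 10 ^+ 4 + 3933) * (t0 * t3) ^+ 2 +
  (8314 * 10 ^+ 4 + 1328) * (t1 * t2) ^+ 2 +
  (5142 * 10 ^+ 4 + 4602) * (t1 * t3) ^+ 2 +
  (690 * 10 ^+ 4 + 1715) * (t2 * t3) ^+ 2 +
  (9829 * 10 ^+ 4 + 1695) * (t0 ^+ 2) ^+ 2 +
  (8762 * 10 ^+ 4 + 117) * (t1 ^+ 2) ^+ 2 +
  (10369 * 10 ^+ 4 + 3975) * (t2 ^+ 2) ^+ 2 +
  (8920 * 10 ^+ 4 + 5345) * (t3 ^+ 2) ^+ 2.

Lemma sos_part_ge0 (R : realDomainType) (t0 t1 t2 t3 : R) :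
  0 <= sos_part t0 t1 t2 t3.
Proof.
rewrite /sos_part.
by repeat match goal with
  | |- is_true (0 <= _ + _) => apply: addr_ge0
  | |- is_true (0 <= _ ^+ 2) => apply: sqr_ge0
  | |- is_true (0 <= _ * _) => apply: mulr_ge0
  | |- is_true (0 <= _ ^+ _) => apply: exprn_ge0
  | |- _ => exact: ler0n
  end.
Qed.

(* The m_k are variables so that they can be instantiated with 0. *)
Lemma minors_certificate (R : comPzRingType) (t0 t1 t2 t3 : R)
    (q00 q01 q02 q03 q11 q12 q13 q22 q23 q33 m0 m1 m2 m3 m4 m5 m6 m7 m8 m9 : R) :
  q00 = 15 * t0 + 83 * t1 - 33 * t2 - 141 * t3 ->
  q01 = - 9 * t0 - 100 * t1 - 286 * t2 - 286 * t3 ->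
  q02 = 105 * t0 - 11 * t1 - 24 * t2 - 28 * t3 ->
  q03 = 16 * t0 - 36 * t1 + 70 * t2 - 539 * t3 ->
  q11 = 57 * t0 - 67 * t1 - 19 * t2 + 269 * t3 ->
  q12 = 15 * t0 + 8 * t1 - 123 * t2 + 166 * t3 ->
  q13 = - 65 * t0 - 74 * t1 - 42 * t2 + 78 * t3 ->
  q22 = - 15 * t0 - 83 * t1 + 33 * t2 + 141 * t3 ->
  q23 = 10 * t0 - 90 * t1 - 65 * t2 + 30 * t3 ->
  q33 = - 45 * t0 + 47 * t1 - 177 * t2 - 159 * t3 ->
  m0 = det3 q00 q01 q02 q01 q11 q12 q02 q12 q22 ->
  m1 = det3 q00 q01 q03 q01 q11 q13 q02 q12 q23 ->
  m2 = det3 q00 q02 q03 q01 q12 q13 q02 q22 q23 ->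
  m3 = det3 q01 q02 q03 q11 q12 q13 q12 q22 q23 ->
  m4 = det3 q00 q01 q03 q01 q11 q13 q03 q13 q33 ->
  m5 = det3 q00 q02 q03 q01 q12 q13 q03 q23 q33 ->
  m6 = det3 q01 q02 q03 q11 q12 q13 q13 q23 q33 ->
  m7 = det3 q00 q02 q03 q02 q22 q23 q03 q23 q33 ->
  m8 = det3 q01 q02 q03 q12 q22 q23 q13 q23 q33 ->
  m9 = det3 q11 q12 q13 q12 q22 q23 q13 q23 q33 ->
  (148 * t0 - 1434 * t1) * m0 +
  (944 * t0 + 1360 * t1 - 1252 * t2 - 2186 * t3) * m1 +
  (316 * t0 + 156 * t1) * m2 +
  (942 * t0 + 1724 * t3) * m3 +
  (64 * t0) * m4 +
  (- 1108 * t0) * m5 +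
  (1298 * t0 + 2998 * t1 - 7042 * t2 - 1372 * t3) * m6 +
  (388 * t0 - 650 * t1 - 2804 * t3) * m7 +
  (- 440 * t0 + 3724 * t1) * m8 +
  (- 4500 * t0 - 2884 * t1 - 7782 * t2 - 13784 * t3) * m9
  = sos_part t0 t1 t2 t3 + (t0 ^+ 4 + t1 ^+ 4 + t2 ^+ 4 + t3 ^+ 4).
Proof. by do 20! move=> ->; rewrite /det3 /sos_part; ring. Qed.

(** The fourth powers set apart in the certificate carry its definiteness: of the remaining squares
    [s], only the sign matters. *)
Lemma sum_pow4_eq0 (R : realDomainType) (s t0 t1 t2 t3 : R) : 0 <= s ->
  s + (t0 ^+ 4 + t1 ^+ 4 + t2 ^+ 4 + t3 ^+ 4) = 0 ->
  [/\ t0 = 0, t1 = 0, t2 = 0 & t3 = 0].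
Proof.
move=> s_ge0; have pow4_ge0 (t : R) : 0 <= t ^+ 4 by exact: exprn_even_ge0.
move/eqP; rewrite !paddr_eq0 ?addr_ge0 // !expf_eq0 /=.
by move=> /andP[_ /andP[/andP[/andP[/eqP-> /eqP->] /eqP->] /eqP->]].
Qed.

(** With q the symmetric matrix of entries q_kl, the hypotheses read |v_j|^2 u_j^T q u_j + |u_j|^2
    v_j^T q v_j = 0, that is tr(P_j q) = 0 scaled by |u_j|^2 |v_j|^2. *)
Lemma projection_annihilator_param (R : realFieldType)
    (q00 q01 q02 q03 q11 q12 q13 q22 q23 q33 : R) :
  33 * q00 + 25 * q11 - 20 * q12 + 20 * q13 + 4 * q22 - 8 * q23 + 4 * q33 = 0
    ->
  25 * q00 - 20 * q02 + 10 * q03 + 30 * q11 + 4 * q22 - 4 * q23 + q33 = 0 ->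
  q00 + q22 = 0 ->
  q00 - 10 * q01 + 6 * q02 + 25 * q11 - 30 * q12 + 9 * q22 + 35 * q33 = 0 ->
  7832 * q00 - 3536 * q01 - 776 * q02 + 744 * q03 + 416 * q11 - 416 * q12 -
    624 * q13 + 5192 * q22 + 7944 * q23 + 3096 * q33 = 0 ->
  421 * q00 - 508 * q01 - 116 * q02 + 426 * q03 + 286 * q11 + 424 * q12 + 156
    * q13 + 244 * q22 + 492 * q23 + 429 * q33 = 0 ->
  exists t0 t1 t2 t3 : R,
    q00 = 15 * t0 + 83 * t1 - 33 * t2 - 141 * t3 /\
    q01 = - 9 * t0 - 100 * t1 - 286 * t2 - 286 * t3 /\
    q02 = 105 * t0 - 11 * t1 - 24 * t2 - 28 * t3 /\
    q03 = 16 * t0 - 36 * t1 + 70 * t2 - 539 * t3 /\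
    q11 = 57 * t0 - 67 * t1 - 19 * t2 + 269 * t3 /\
    q12 = 15 * t0 + 8 * t1 - 123 * t2 + 166 * t3 /\
    q13 = - 65 * t0 - 74 * t1 - 42 * t2 + 78 * t3 /\
    q22 = - 15 * t0 - 83 * t1 + 33 * t2 + 141 * t3 /\
    q23 = 10 * t0 - 90 * t1 - 65 * t2 + 30 * t3 /\
    q33 = - 45 * t0 + 47 * t1 - 177 * t2 - 159 * t3.
Proof.
move=> e0 e1 e2 e3 e4 e5.
(* The witnesses are an integral left inverse of the parametrization; on the solution space it is a
   two-sided inverse, so each identity is a linear combination of [e0], ..., [e5]. *)
exists (8 * q00 + 24 * q01 - 24 * q02 - 32 * q03 - 3 * q11 - 49 * q12 - 44 *
  q13 - 8 * q22 + 29 * q23 - 17 * q33).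
exists (56 * q00 + 24 * q01 - 53 * q02 - 78 * q03 - 38 * q11 - 106 * q12 - 79
  * q13 - 56 * q22 + 172 * q23 - 50 * q33).
exists (38 * q00 - 25 * q01 - 30 * q02 - 16 * q03 - 17 * q11 - 23 * q12 - 28 *
  q13 - 38 * q22 + 140 * q23 - 3 * q33).
exists (37 * q00 + 43 * q01 - 51 * q02 - 68 * q03 - 10 * q11 - 102 * q12 - 75
  * q13 - 36 * q22 + 89 * q23 - 46 * q33).
by do !split; lra.
Qed.

(** Up to transposition, the ten determinants are all the 3 x 3 minors of q. Their vanishing kills
    the left side of the certificate, which forces t = 0 and hence q = 0. *)
Lemma projection_annihilator_minors_eq0 (R : realFieldType)
    (q00 q01 q02 q03 q11 q12 q13 q22 q23 q33 : R) :
  33 * q00 + 25 * q11 - 20 * q12 + 20 * q13 + 4 * q22 - 8 * q23 + 4 * q33 = 0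
    ->
  25 * q00 - 20 * q02 + 10 * q03 + 30 * q11 + 4 * q22 - 4 * q23 + q33 = 0 ->
  q00 + q22 = 0 ->
  q00 - 10 * q01 + 6 * q02 + 25 * q11 - 30 * q12 + 9 * q22 + 35 * q33 = 0 ->
  7832 * q00 - 3536 * q01 - 776 * q02 + 744 * q03 + 416 * q11 - 416 * q12 -
    624 * q13 + 5192 * q22 + 7944 * q23 + 3096 * q33 = 0 ->
  421 * q00 - 508 * q01 - 116 * q02 + 426 * q03 + 286 * q11 + 424 * q12 + 156
    * q13 + 244 * q22 + 492 * q23 + 429 * q33 = 0 ->
  0 = det3 q00 q01 q02 q01 q11 q12 q02 q12 q22 ->
  0 = det3 q00 q01 q03 q01 q11 q13 q02 q12 q23 ->
  0 = det3 q00 q02 q03 q01 q12 q13 q02 q22 q23 ->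
  0 = det3 q01 q02 q03 q11 q12 q13 q12 q22 q23 ->
  0 = det3 q00 q01 q03 q01 q11 q13 q03 q13 q33 ->
  0 = det3 q00 q02 q03 q01 q12 q13 q03 q23 q33 ->
  0 = det3 q01 q02 q03 q11 q12 q13 q13 q23 q33 ->
  0 = det3 q00 q02 q03 q02 q22 q23 q03 q23 q33 ->
  0 = det3 q01 q02 q03 q12 q22 q23 q13 q23 q33 ->
  0 = det3 q11 q12 q13 q12 q22 q23 q13 q23 q33 ->
  [/\ [/\ q00 = 0, q01 = 0, q02 = 0, q03 = 0 & q11 = 0] &
      [/\ q12 = 0, q13 = 0, q22 = 0, q23 = 0 & q33 = 0]].
Proof.
move=> e0 e1 e2 e3 e4 e5 m0 m1 m2 m3 m4 m5 m6 m7 m8 m9.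
have [t0 [t1 [t2 [t3]]]] := projection_annihilator_param e0 e1 e2 e3 e4 e5.
move=> [E00 [E01 [E02 [E03 [E11 [E12 [E13 [E22 [E23 E33]]]]]]]]].
have [||z0 z1 z2 z3] := @sum_pow4_eq0 R (sos_part t0 t1 t2 t3) t0 t1 t2 t3.
- exact: sos_part_ge0.
(* Each m_k is instantiated with 0, so that [ring] never sees the minors. *)
- rewrite -(minors_certificate E00 E01 E02 E03 E11 E12 E13 E22 E23 E33
    m0 m1 m2 m3 m4 m5 m6 m7 m8 m9).
  ring.
by rewrite E00 E01 E02 E03 E11 E12 E13 E22 E23 E33 z0 z1 z2 z3;
  do 2?split; ring.
Qed.

(** If a_i is nonzero, the diagonal entry 2 a_i b_i gives b_i = 0, and then row i reduces to a_i b_j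
    = 0. *)
Lemma symprod_eq0 (R : fieldType) n (a b : 'cV[R]_n) : (2 : R) != 0 ->
  (forall i j, a i 0 * b j 0 + a j 0 * b i 0 = 0) -> a = 0 \/ b = 0.
Proof.
move=> nz2 ab0; have [|/cV0Pn[i nzai]] := eqVneq a 0; [by left | right].
have bi0 : b i 0 = 0.
  apply/eqP; have /eqP := ab0 i i.
  by rewrite -mulr2n -mulr_natl !mulf_eq0 (negPf nz2) (negPf nzai).
apply/colP => j; rewrite mxE; apply/eqP; have /eqP := ab0 i j.
by rewrite bi0 mulr0 addr0 mulf_eq0 (negPf nzai).
Qed.

(** This is |p|^2 = <u,x>^2 / |u|^2 + <v,x>^2 / |v|^2 cleared of denominators. Since x - p is
    orthogonal to u and v, x can be replaced by p = k u + l v. *)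
Lemma orthoproj_span2 (R : rcfType) n (u v x : 'cV[R]_n) (uv0 : dot u v = 0) :
  let p := orthoproj <<[:: u; v]>>%VS x in
  dot u u * dot v v * dot p p = dot v v * dot u x ^+ 2 + dot u u * dot v x ^+ 2.
Proof.
move=> p.
have dotC (y z : 'cV[R]_n) : dot y z = dot z y by rewrite dot_sym mul1r.
have pW : p \in <<[:: u; v]>>%VS by exact: orthoproj_mem.
have px w : w \in <<[:: u; v]>>%VS -> dot w x = dot w p.
  move=> wW; apply/eqP; rewrite -subr_eq0 -linearBr /= dotC.
  by rewrite orthoproj_ortho.
have -> : dot u x = dot u p by apply: px; rewrite memv_span ?mem_head.
have -> : dot v x = dot v p by apply: px; rewrite memv_span ?inE ?eqxx ?orbT.
move: pW; rewrite span_cons span_seq1.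
move=> /memv_addP[_ /vlineP[k ->] [_ /vlineP[l ->] ->]].
rewrite !(linearDl, linearDr, linearZl_LR, linearZr) /= (dotC v u) uv0; ring.
Qed.

(** Subtract the formulas for x and y and factor <u,x>^2 - <u,y>^2 = <u,x+y> <u,x-y>, and likewise
    for v. *)
Lemma enorm_orthoproj_span2 (R : rcfType) n (u v x y : 'cV[R]_n) :
  dot u v = 0 ->
  enorm (orthoproj <<[:: u; v]>>%VS x) = enorm (orthoproj <<[:: u; v]>>%VS y) ->
  dot v v * (dot u (x + y) * dot u (x - y)) +
  dot u u * (dot v (x + y) * dot v (x - y)) = 0.
Proof.
move=> uv0 /eqP; have ge0 (z : 'cV[R]_n) : 0 <= dot z z.
  by apply: sumr_ge0 => i _; rewrite -expr2 sqr_ge0.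
rewrite /enorm eqr_sqrt // => /eqP pxy.
have := orthoproj_span2 x uv0; rewrite /= pxy orthoproj_span2 // => E.
by rewrite !(linearDr, linearNr) /=; move: E; lra.
Qed.

Theorem theorem4p2 (R : realType) :
  yields_phase_retrieval
    (fun j : 'I_6 => <<[:: col j (matU R); col j (matV R)]>>%VS).
Proof.
move=> x y nPxy.
have uv0 (j : 'I_6) : dot (col j (matU R)) (col j (matV R)) = 0.
  rewrite /dot !big_ord_recl big_ord0 !mxE /=.
  by case: j => [[|[|[|[|[|[|//]]]]]] ?] /=; ring.
have eqn j := enorm_orthoproj_span2 (uv0 j) (nPxy j).
have dot4 (u v : 'cV[R]_4) : dot u v = u 0 0 * v 0 0 + u 1 0 * v 1 0 +
    u 2%:R 0 * v 2%:R 0 + u 3%:R 0 * v 3%:R 0.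
  rewrite /dot !big_ord_recl big_ord0 addr0 !addrA.
  do !congr (_ + _); congr (_ * _); congr (fun_of_matrix _ _ _);
    exact: val_inj.
suff [xy0 | xy0] : x + y = 0 \/ x - y = 0.
- by right; apply/eqP; rewrite -addr_eq0 xy0.
- by left; apply/eqP; rewrite -subr_eq0 xy0.
apply: symprod_eq0 => [|i j]; first by rewrite pnatr_eq0.
move: (x + y) (x - y) eqn => a b eqn.
pose q i j := a i 0 * b j 0 + a j 0 * b i 0.
rewrite -/(q i j).
have e0 := eqn 0; have e1 := eqn 1; have e2 := eqn 2%:R.
have e3 := eqn 3%:R; have e4 := eqn 4%:R; have e5 := eqn 5%:R.
rewrite !dot4 !mxE /= in e0 e1 e2 e3 e4 e5; move=> {eqn}.
have [||||||||||||||||[q00 q01 q02 q03 q11] [q12 q13 q22 q23 q33]] :=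
  @projection_annihilator_minors_eq0 R
    (q 0 0) (q 0 1) (q 0 2%:R) (q 0 3%:R) (q 1 1)
    (q 1 2%:R) (q 1 3%:R) (q 2%:R 2%:R) (q 2%:R 3%:R) (q 3%:R 3%:R).
(* As u^T q u = 2 <u,a> <u,b>, each condition is twice the matching [e0], ..., [e5], linearly in the
   products a_k b_l. *)
1-6: by rewrite /q; lra.
(* The minors vanish identically in a and b, because a b^T + b a^T has rank at most 2. *)
1-10: by rewrite /det3 /q; ring.
have qC k l : q k l = q l k by rewrite /q addrC.
have I4P (k : 'I_4) : [\/ k = 0, k = 1, k = 2%:R | k = 3%:R].
  case: k => [[|[|[|[|//]]]] ltk];
    [apply: Or41 | apply: Or42 | apply: Or43 | apply: Or44]; exact: val_inj.
by case: (I4P i) => ->; case: (I4P j) => ->; rewrite // qC.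
Qed.
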